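(* For every infinite cardinal $\kappa$, $dis(\Sigma(2^{\kappa})) = \kappa^\omega$.
   Context: $\Sigma(2^\kappa)$ is the $\Sigma$-product of the Cantor cube $2^\kappa$: the subspace of $\{0,1\}^\kappa$ (with the product topology, $\{0,1\}$ discrete) consisting of all points $x$ whose support $\{\alpha<\kappa : x(\alpha) \neq 0\}$ is countable. $dis(X)$ denotes the least number of discrete sets required to cover $X$ (a subset of $X$ is discrete if its subspace topology is discrete; it need not be closed in $X$). $\kappa^\omega$ denotes cardinal exponentiation. *)

(* Defs.v *)
From HB Require Import structures.
From mathcomp Require Import all_boot all_order all_algebra.
From mathcomp Require Import all_classical all_reals all_analysis.

Set Implicit Arguments.
Unset Strict Implicit.
Unset Printing Implicit Defensive.

Local Open Scope classical_set_scope.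
Local Open Scope card_scope.

(* The subspace topology is that of [set_type A] (initial topology of the
   inclusion), so A need not be closed in X. *)
Definition discrete_subset (X : topologicalType) (A : set X) : Prop :=
  (nbhs : A -> set_system A) = principal_filter.

Definition discrete_cover (X : topologicalType) (D : set (set X)) : Prop :=
  (forall A, D A -> discrete_subset A) /\ \bigcup_(A in D) A = [set: X].

(* dis(X) = |A|.  Cardinals are represented by sets compared with [#=] and
   [#<=], so dis(X) is given by the relation "the least cardinality of a cover
   of X by discrete sets is the cardinality of A". *)
Definition dis_is (X : topologicalType) (U : Type) (A : set U) : Prop :=
  (exists2 D : set (set X), discrete_cover D & D #= A) /\
  (forall D : set (set X), discrete_cover D -> A #<= D).

(* [{ptws K -> bool}] carries the product topology, bool being discrete. *)
Definition Sigma_set (K : Type) : set {ptws K -> bool} :=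
  [set x | countable [set a | x a != false]].
Arguments Sigma_set : clear implicits.

Definition Sigma_space (K : Type) : topologicalType := set_type (Sigma_set K).

(* Main.v *)
Require Import Defs.
From mathcomp Require Import all_boot all_order all_algebra.
From mathcomp Require Import all_classical all_reals all_analysis.

(** Write k for the cardinality of K.

    Covering by singletons bounds dis from above: a point of the Sigma-product
    is determined by its countable support, hence by a sequence of elements of
    K that may skip some indices, so there are at most k^omega points
    ([card_Sigma_space_le]).

    For the lower bound, fix an injection p of nat * K into K and send
    f : nat -> K to the indicator function of its graph, transported along p.
    This embeds the Baire space K^nat (K discrete) in the Sigma-product
    ([Sigma_graph_continuous], [Sigma_graph_inj]). Let D be a cover by discrete
    sets. Every f lies in some A_f in D, and discreteness gives an n_f such that
    no other member of A_f agrees with f on the first n_f places. Thus f is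
    determined by A_f together with its first n_f values, and
    [card_fun_le_labels] derives k^omega <= |D| from this alone:
    - if k <= |D|, the label A_f and the finite sequence are coded by a finite
      sequence of elements of D, and there are only |D| of those;
    - otherwise, for each finite sequence s of length n, the functions f that
      extend s and have n_f = n carry different labels, so they take fewer than
      k values at n. Hence some f avoids, at every n, the values that its own
      first n values forbid in this way; but its value at n_f is forbidden.

    The cardinal arithmetic behind the first case and behind p is |seq T| = |T|
    for infinite T, which follows from Hessenberg's theorem |T * T| = |T|. *)

Set Implicit Arguments.
Unset Strict Implicit.

Local Open Scope classical_set_scope.
Local Open Scope card_scope.

(** * Cardinal arithmetic *)

Lemma card_le_injP (T U : Type) (A : set T) (B : set U) (u : U) :
  A #<= B <-> exists2 f : T -> U, set_fun A B f & set_inj A f.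
Proof.
rewrite -injfunPex; elim/Ppointed: U => U in B u *; first by have := no u.
by split=> /pcard_leP.
Qed.

Lemma card_leTP (T U : Type) :
  [set: T] #<= [set: U] <-> exists f : T -> U, injective f.
Proof.
split=> [/card_leP[f]|[f f_inj]].
  exists (fun t => \val (f (to_setT t))) => s t /val_inj /(@inj _ _ _ f).
  by rewrite !inE => /(_ I I) /(congr1 val).
have [|g] := (@injfunPex T U setT setT).2; first by exists f => // s t _ _ /f_inj.
exact: inj_card_le g.
Qed.

Lemma bigcup_total_mem2 (T : Type) (F : set (set T)) (x y : T) :
  total_on F subset -> (\bigcup_(X in F) X) x -> (\bigcup_(X in F) X) y ->
  exists X, [/\ F X, X x & X y].
Proof.
move=> Ftot [X FX Xx] [Y FY Yy].
by have [XY|YX] := Ftot X Y FX FY; [exists Y|exists X]; split=> //;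
  [exact: XY|exact: YX].
Qed.

(** Comparability of cardinals. A maximal partial bijection between [A] and
    [B] is total on one of the two sides, since otherwise it could be extended
    by one more pair. *)
Lemma card_le_total (T U : Type) (A : set T) (B : set U) :
  A #<= B \/ B #<= A.
Proof.
pose P (R : set (T * U)) :=
  [/\ R `<=` A `*` B, forall a b b', R (a, b) -> R (a, b') -> b = b'
    & forall a a' b, R (a, b) -> R (a', b) -> a = a'].
have [F FP Ftot|R [[RAB Rfun Rinj] Rmax]] := @Zorn_bigcup _ P.
  split=> [x [X FX Xx]|a b b' h h'|a a' b h h'].
  - by have [+ _ _] := FP _ FX; exact.
  - have [X [FX Xb Xb']] := bigcup_total_mem2 Ftot h h'.
    by have [_ Xfun _] := FP _ FX; exact: Xfun Xb Xb'.
  - have [X [FX Xb Xb']] := bigcup_total_mem2 Ftot h h'.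
    by have [_ _ Xinj] := FP _ FX; exact: Xinj Xb Xb'.
have [[a [Aa nRa]]|totA] := pselect (exists a, A a /\ forall b, ~ R (a, b)); last first.
  left; have RA a : A a -> exists b, R (a, b).
    by move=> Aa; apply: contrapT => nR; apply: totA; exists a; split=> // b Rab;
       apply: nR; exists b.
  have [u|noU] := pselect (inhabited U); last first.
    rewrite (_ : A = set0) ?card_ge0//; apply/seteqP; split=> // a /RA[b _].
    by apply: noU; exists.
  case: u => u; apply/(card_le_injP _ _ u).
  have /choice[f Rf] : forall a, exists b, A a -> R (a, b).
    by move=> a; have [/RA[b Rab]|nAa] := pselect (A a); [exists b|exists u].
  exists f => [a Aa|a a' /set_mem/Rf Rfa /set_mem/Rf Rfa' ff].
    by have /RAB[] := Rf _ Aa.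
  by apply: Rinj Rfa _; rewrite ff.
right; have RB b : B b -> exists a', R (a', b).
  move=> Bb; apply: contrapT => nRb; apply: (Rmax (R `|` [set (a, b)])).
    split=> [x Rx|/(_ (a, b)) h]; first by left.
    by apply: (nRa b); apply: h; right.
  split=> [x [/RAB//|->//]|a' b1 b2|a1 a2 b'].
  - move=> [h1|[E1 F1]] [h2|[E2 F2]].
    + exact: Rfun h1 h2.
    + by case: (nRa b1); rewrite -E2.
    + by case: (nRa b2); rewrite -E1.
    + by rewrite F1 F2.
  - move=> [h1|[E1 F1]] [h2|[E2 F2]].
    + exact: Rinj h1 h2.
    + by case: nRb; exists a1; rewrite -F2.
    + by case: nRb; exists a2; rewrite -F1.
    + by rewrite E1 E2.
apply/(card_le_injP _ _ a).
have /choice[f Rf] : forall b, exists a', B b -> R (a', b).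
  by move=> b; have [/RB[a' Rab]|nBb] := pselect (B b); [exists a'|exists a].
exists f => [b Bb|b b' /set_mem/Rf Rfb /set_mem/Rf Rfb' ff].
  by have /RAB[] := Rf _ Bb.
by apply: Rfun Rfb _; rewrite ff.
Qed.

(** A set of triples [G] encodes an injective pairing of a subset of [T] with
    values in that same subset, the subset being read off the diagonal. Such
    sets are ordered by inclusion, as Zorn's lemma requires, and the pairing
    may be multivalued: values are chosen only once a maximal one is found. *)
Definition pairing_carrier (T : Type) (G : set (T * T * T)) : set T :=
  [set a | exists c, G (a, a, c)].

Definition pairing_graph (T : Type) (G : set (T * T * T)) : Prop :=
  [/\ forall a b c, G (a, b, c) ->
        [/\ pairing_carrier G a, pairing_carrier G b & pairing_carrier G c],
      forall a b, pairing_carrier G a -> pairing_carrier G b ->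
        exists c, G (a, b, c)
    & forall a b a' b' c, G (a, b, c) -> G (a', b', c) -> a = a' /\ b = b'].

Lemma pairing_graph_bigcup (T : Type) (F : set (set (T * T * T))) :
  F `<=` @pairing_graph T -> total_on F subset ->
  pairing_graph (\bigcup_(G in F) G).
Proof.
move=> Fpair Ftot.
split=> [a b c [G FG Gabc]|a b [c ac] [d bd]|a b a' b' c abc abc'].
- have [Gcl _ _] := Fpair _ FG.
  by have [[a' ?] [b' ?] [c' ?]] := Gcl _ _ _ Gabc;
    split; [exists a'|exists b'|exists c']; exists G.
- have [G [FG Gac Gbd]] := bigcup_total_mem2 Ftot ac bd.
  have [_ Gtot _] := Fpair _ FG.
  by have [|| e Ge] := Gtot a b; [exists c|exists d|exists e, G].
- have [G [FG Gabc Gabc']] := bigcup_total_mem2 Ftot abc abc'.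
  by have [_ _ Ginj] := Fpair _ FG; exact: Ginj Gabc Gabc'.
Qed.

(** The bijection of nat * nat with nat, transported to [T]. Maximal pairings
    are sought above this one, so that their carrier contains two distinct
    points. *)
Lemma pairing_graph_nat (T : Type) (i : nat -> T) : injective i ->
  pairing_graph [set (i mn.1, i mn.2, i (choice.pickle mn)) | mn in [set: nat * nat]].
Proof.
set G := (X in pairing_graph X) => i_inj.
have Gi n : pairing_carrier G (i n).
  by exists (i (choice.pickle (n, n))), (n, n).
have carrierE a : pairing_carrier G a -> exists n, a = i n.
  by move=> [_ [[m n] _ [<- _ _]]]; exists m.
split=> [_ _ _ [[m n] _ [<- <- <-]]|a b /carrierE[m ->] /carrierE[n ->]|].
- by split; exact: Gi.
- by exists (i (choice.pickle (m, n))), (m, n).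
- move=> _ _ _ _ _ [[m n] _ [<- <- <-]] [[m' n'] _ [<- <-]] /i_inj.
  by move=> /(pcan_inj choice.pickleK)[-> ->].
Qed.

(** If |W \ S| <= |S|, then W injects into two disjoint copies of [S], which
    the pairing [q] provides inside [S] as the values q s0 _ and q s1 _. *)
Lemma injective_into_carrier (T : Type) (S W : set T) (q : T -> T -> T)
    (r : T -> T) (s0 s1 : T) :
  (forall a b, S a -> S b -> S (q a b)) ->
  (forall a b a' b', S a -> S b -> S a' -> S b' ->
     q a b = q a' b' -> a = a' /\ b = b') ->
  S s0 -> S s1 -> s0 <> s1 -> set_fun (W `\` S) S r -> set_inj (W `\` S) r ->
  exists2 u : T -> T, set_fun W S u & set_inj W u.
Proof.
move=> qS q_inj S0 S1 s01 rS r_inj.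
have rWS t : W t -> ~ S t -> S (r t) by move=> Wt nSt; exact: rS.
exists (fun t => if pselect (S t) then q s0 t else q s1 (r t)) => [t Wt|t t'].
  by case: pselect => St; apply: qS => //; exact: rWS.
move=> /set_mem Wt /set_mem Wt'; case: pselect => St; case: pselect => St' qq.
- by have [] := q_inj _ _ _ _ S0 St S0 St' qq.
- by have [] := q_inj _ _ _ _ S0 St S1 (rWS _ Wt' St') qq.
- by have [/esym] := q_inj _ _ _ _ S1 (rWS _ Wt St) S0 St' qq.
- have [_ rr] := q_inj _ _ _ _ S1 (rWS _ Wt St) S1 (rWS _ Wt' St') qq.
  by apply: r_inj rr; rewrite inE.
Qed.

(** Let [S] be the carrier. If the complement of [S] injects into [S], so does
    all of [T], and the pairing on [S] can be pulled back to [T]. Otherwise [S]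
    has a disjoint copy h(S) in its complement, and the pairing extends to the
    union W of [S] and h(S): W still injects into [S], so that the new pairs can
    be coded in [S] and then moved by h to values that are not in use yet. This
    contradicts maximality. *)
Lemma pairing_graph_maximal (T : Type) (G : set (T * T * T)) (s0 s1 : T) :
  pairing_graph G -> pairing_carrier G s0 -> pairing_carrier G s1 -> s0 <> s1 ->
  (forall H, G `<` H -> ~ pairing_graph H) -> [set: T * T] #<= [set: T].
Proof.
set S := pairing_carrier G => -[Gcl Gtot Ginj] S0 S1 s01 Gmax.
have /choice[q' Gq'] : forall ab : T * T, exists c, S ab.1 -> S ab.2 -> G (ab.1, ab.2, c).
  move=> [a b] /=; have [[Sa Sb]|nS] := pselect (S a /\ S b).
    by have [c Gc] := Gtot a b Sa Sb; exists c.
  by exists a => Sa Sb; case: nS.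
pose q a b := q' (a, b).
have Gq a b : S a -> S b -> G (a, b, q a b) by exact: (Gq' (a, b)).
have qS a b : S a -> S b -> S (q a b).
  by move=> Sa Sb; have [] := Gcl _ _ _ (Gq _ _ Sa Sb).
have q_inj a b a' b' : S a -> S b -> S a' -> S b' ->
    q a b = q a' b' -> a = a' /\ b = b'.
  move=> Sa Sb Sa' Sb' qq; apply: (Ginj _ _ _ _ (q a b)); first exact: Gq.
  by rewrite qq; exact: Gq.
have [] := card_le_total (~` S) S => /(card_le_injP _ _ s0)[h hS h_inj].
  have [||u uS u_inj] :=
      @injective_into_carrier T S setT q h s0 s1 qS q_inj S0 S1 s01; rewrite ?setTD//.
  have {}u_inj t t' : u t = u t' -> t = t' by apply: u_inj; rewrite inE.
  apply/card_leTP; exists (fun ab => q (u ab.1) (u ab.2)) => -[a b] [a' b'] /=.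
  move=> /q_inj[]; try exact: uS.
  by move=> /u_inj -> // /u_inj ->.
(* The extension to [W] contradicts maximality; [r] inverts [h] on its image. *)
exfalso; pose W := S `|` h @` S.
have /choice[r hr] : forall t, exists s, (h @` S) t -> S s /\ h s = t.
  move=> t; have [[s Ss <-]|nt] := pselect ((h @` S) t); first by exists s.
  by exists t => ht; case: nt.
have WS t : (W `\` S) t -> (h @` S) t by move=> [[]].
have [||u uS u_inj] := @injective_into_carrier T S W q r s0 s1 qS q_inj S0 S1 s01.
- by move=> t /WS/hr[].
- by move=> t t' /set_mem/WS/hr[_ ht] /set_mem/WS/hr[_ ht'] rr; rewrite -ht rr.
have {}u_inj t t' : W t -> W t' -> u t = u t' -> t = t'.
  by move=> Wt Wt'; apply: u_inj; rewrite inE.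
pose new abc := [/\ W abc.1.1, W abc.1.2, ~ (S abc.1.1 /\ S abc.1.2) &
  abc.2 = h (q (u abc.1.1) (u abc.1.2))].
pose H := G `|` [set abc | new abc].
have newC a b c : new (a, b, c) -> (h @` S) c.
  by move=> [/= Wa Wb _ ->]; exists (q (u a) (u b)) => //; apply: qS; exact: uS.
have Htot a b : W a -> W b -> exists c, H (a, b, c).
  move=> Wa Wb; have [[Sa Sb]|nS] := pselect (S a /\ S b).
    by exists (q a b); left; exact: Gq.
  by exists (h (q (u a) (u b))); right.
have HW : pairing_carrier H = W.
  apply/seteqP; split=> [a [c [/Gcl[Sa _ _]|[]//]]|a Wa]; first by left.
  exact: Htot.
apply: (Gmax H).
  split=> [x Gx|HG]; first by left.
  have : pairing_carrier H (h s0) by rewrite HW; right; exists s0.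
  by move=> [c /HG Gc]; apply: (hS s0 S0); exists c.
split; rewrite ?HW => //.
- move=> a b c [/Gcl[Sa Sb Sc]|nabc]; first by split; left.
  by have := newC _ _ _ nabc; case: nabc => Wa Wb _ _ hc; split=> //; right.
- have disj a b c a' b' : G (a, b, c) -> ~ new (a', b', c).
    by move=> /Gcl[_ _ Sc] /newC[s Ss hsc]; apply: (hS s Ss); rewrite hsc.
  move=> a b a' b' c [h1|h1] [h2|h2].
  + exact: Ginj h1 h2.
  + by case: (disj _ _ _ _ _ h1 h2).
  + by case: (disj _ _ _ _ _ h2 h1).
  + case: h1 h2 => /= Wa Wb _ -> [/= Wa' Wb' _ /h_inj].
    rewrite !inE => /(_ (qS _ _ (uS _ Wa) (uS _ Wb)) (qS _ _ (uS _ Wa') (uS _ Wb'))).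
    move=> /q_inj[]; try exact: uS.
    by move=> /u_inj -> // /u_inj ->.
Qed.

(** Hessenberg's theorem. *)
Lemma card_prod_le (T : Type) : infinite_set [set: T] -> [set: T * T] #<= [set: T].
Proof.
move=> /infiniteP/card_leTP[i i_inj].
have Gi := pairing_graph_nat i_inj; set Gnat := (X in pairing_graph X) in Gi.
pose P (G : set (T * T * T)) := pairing_graph G /\ (G = set0 \/ Gnat `<=` G).
(* The empty set is admitted in [P] because it is the union of the empty chain. *)
have [F FP Ftot|G [[Gpair G0] Gmax]] := @Zorn_bigcup _ P.
  split; first by apply: pairing_graph_bigcup Ftot => G /FP[].
  have [[G [FG GnatG]]|noG] := pselect (exists G, F G /\ Gnat `<=` G).
    by right=> x /GnatG Gx; exists G.
  left; apply/seteqP; split=> // x [G FG Gx].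
  by have [_ [G0|GnatG]] := FP _ FG; [rewrite G0 in Gx|case: noG; exists G].
have GnatG : Gnat `<=` G.
  case: G0 => // G0; case: (Gmax Gnat); last by split=> //; right.
  rewrite G0; split=> // /(_ (i 0, i 0, i (choice.pickle (0, 0)))); apply.
  by exists (0, 0).
have Gcar n : pairing_carrier G (i n).
  by exists (i (choice.pickle (n, n))); apply: GnatG; exists (n, n).
apply: (@pairing_graph_maximal T G (i 0) (i 1)) => // [/i_inj//|H GH Hpair].
apply: (Gmax H GH); split=> //; right; apply: subset_trans GnatG _.
by case: GH.
Qed.

(** Iterating a pairing codes the sequences of a given length injectively; the
    length itself is paired with the resulting code. *)
Lemma card_seq_le (T : Type) : infinite_set [set: T] -> [set: seq T] #<= [set: T].
Proof.
move=> infT; have /card_leTP[p p_inj] := card_prod_le infT.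
have /infiniteP/card_leTP[i i_inj] := infT.
pose code := foldr (fun x c => p (x, c)) (i 0).
have code_inj s t : size s = size t -> code s = code t -> s = t.
  by elim: s t => [|x s IH] [|y t] //= [/IH sE] /p_inj[-> /sE ->].
apply/card_leTP; exists (fun s => p (i (size s), code s)) => s t /p_inj[/i_inj].
exact: code_inj.
Qed.

(** * Product and initial topologies *)

Lemma cvg_initial (S : choiceType) (T : topologicalType) (f : S -> T)
    (F : set_system S) (s : S) : Filter F ->
  f @ F --> f s -> F --> (s : initial_topology f).
Proof.
move=> FF fF U [_ [[V oV <-] Vfs sVU]]; apply: filterS sVU _.
by apply: fF; apply: open_nbhs_nbhs.
Qed.

Lemma cvg_prod_topology (I : Type) (T : I -> topologicalType)
    (F : set_system (prod_topology T)) (f : prod_topology T) : Filter F ->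
  (forall i, proj i @ F --> f i) -> F --> f.
Proof.
by move=> FF cF; apply/cvg_sup => i; apply: cvg_initial; exact: cF.
Qed.

(** * Functions determined by a label and a finite prefix *)

Lemma exists_avoiding (K : Type) (bad : seq K -> set K) :
  (forall s, bad s != setT) -> exists f : nat -> K, forall n, ~ bad (mkseq f n) (f n).
Proof.
move=> badT; have /choice[next nextP] : forall s, exists k, ~ bad s k.
  by move=> s; have /setTPn[k bk] := badT s; exists k.
pose prefix := fix prefix n :=
  if n is n.+1 then rcons (prefix n) (next (prefix n)) else [::].
exists (fun n => next (prefix n)) => n.
rewrite (_ : mkseq _ n = prefix n); first exact: nextP.
by elim: n => //= n IH; rewrite mkseqS IH.
Qed.

(** If there are at least |K| labels, a label and a prefix together form a
    finite sequence of labels. If there are fewer, the values that functions of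
    depth [size s] extending [s] take right after [s] do not exhaust [K], since
    these functions have distinct labels; so some function avoids such values
    at every place, and yet attains one at its own depth. *)
Lemma card_fun_le_labels (K I : Type) (label : (nat -> K) -> I)
    (depth : (nat -> K) -> nat) :
  infinite_set [set: K] ->
  (forall f g, label f = label g -> mkseq f (depth f) = mkseq g (depth f) -> f = g) ->
  [set: nat -> K] #<= [set: I].
Proof.
move=> infK sep; have [KI|nKI] := boolP ([set: K] #<= [set: I]).
  have infI : infinite_set [set: I] by move=> /(card_le_finite KI).
  apply: card_le_trans (card_seq_le infI).
  have /card_leTP[j j_inj] := KI.
  apply/card_leTP; exists (fun f => label f :: map j (mkseq f (depth f))) => f g.
  move=> [lfg /(inj_map j_inj) E]; apply: sep => //; rewrite E.
  by move: (congr1 size E); rewrite !size_mkseq => ->.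
pose bad (s : seq K) := [set k | exists f : nat -> K,
  [/\ depth f = size s, mkseq f (size s) = s & f (size s) = k]].
have [|f /(_ (depth f))] := @exists_avoiding K bad; last first.
  by case; exists f; rewrite size_mkseq.
move=> s; apply: contraNN nKI => /eqP badT.
have /choice[F FP] : forall k, bad s k by move=> k; rewrite badT.
apply/card_leTP; exists (label \o F) => k l /= lkl.
have [dk sk Fk] := FP k; have [_ sl Fl] := FP l.
by rewrite -Fk (sep (F k) (F l)) // ?dk ?sk.
Qed.

(** * The Baire space inside the Sigma-product *)

Definition graph_fun (K : Type) (p : nat * K -> K) (f : nat -> K) : {ptws K -> bool} :=
  fun a => `[< exists n, a = p (n, f n) >].

Lemma graph_funP (K : Type) (p : nat * K -> K) (f : nat -> K) n k : injective p ->
  graph_fun p f (p (n, k)) = `[< f n = k >].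
Proof.
by move=> p_inj; apply/asbool_equiv_eq; split=> [[m /p_inj[-> ->]]|<-]; [|exists n].
Qed.

Lemma Sigma_graph_fun (K : Type) (p : nat * K -> K) (f : nat -> K) :
  graph_fun p f \in Sigma_set K.
Proof.
rewrite inE /Sigma_set /=.
apply: (@sub_countable _ _ _ (range (fun n => p (n, f n)))).
  apply: subset_card_le => a /=; rewrite /graph_fun.
  by have [[n ->] _|//] := asboolP; exists n.
exact: card_image_le.
Qed.

Definition Sigma_graph (K : Type) (p : nat * K -> K) (f : nat -> K) :
  Sigma_space K := exist _ (graph_fun p f) (Sigma_graph_fun p f).

(** Continuity of the embedding. The coordinate p (n, k) of the image of [f] only
    depends on whether f n = k, and coordinates outside the image of [p]
    vanish; so every coordinate is determined by a finite prefix of [f]. *)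
Lemma Sigma_graph_continuous (K : Type) (p : nat * K -> K) (f : nat -> K)
    (U : set (Sigma_space K)) : injective p -> nbhs (Sigma_graph p f) U ->
  exists n, forall g, mkseq f n = mkseq g n -> U (Sigma_graph p g).
Proof.
move=> p_inj.
(* [F] is the filter of neighbourhoods of [f] in the Baire space. *)
pose F : set_system (nat -> K) :=
  [set P | exists n, forall g, mkseq f n = mkseq g n -> P g].
have mkseq_le g m n : (m <= n)%N -> mkseq f n = mkseq g n -> mkseq f m = mkseq g m.
  move=> mn /eq_in_map fg; apply/eq_in_map => i; rewrite mem_iota => /andP[_ im].
  by apply: fg; rewrite mem_iota /= (leq_trans im).
have FF : Filter F.
  split; first by exists 0%N.
    move=> P Q [m mP] [n nQ]; exists (maxn m n) => g fg; split.
      by apply: mP; apply: mkseq_le fg; rewrite leq_maxl.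
    by apply: nQ; apply: mkseq_le fg; rewrite leq_maxr.
  by move=> P Q PQ [n nP]; exists n => g /nP; exact: PQ.
suff : Sigma_graph p @ F --> Sigma_graph p f by apply.
apply: cvg_initial; apply: cvg_prod_topology => a.
suff [n fg] : exists n, forall g, mkseq f n = mkseq g n ->
    graph_fun p g a = graph_fun p f a.
  move=> V /= Va; exists n => g /fg ga; change (V (graph_fun p g a)).
  by rewrite ga; exact: nbhs_singleton.
have [[[n k] ->]|na] := pselect (exists nk, a = p nk).
  exists n.+1 => g /eq_in_map fg; rewrite !graph_funP // fg//.
  by rewrite mem_iota /=.
have gE g : graph_fun p g a = false.
  by apply/asboolPn => -[n an]; apply: na; exists (n, g n).
by exists 0%N => g _; rewrite !gE.
Qed.

Lemma Sigma_graph_inj (K : Type) (p : nat * K -> K) :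
  injective p -> injective (Sigma_graph p).
Proof.
move=> p_inj f g /(congr1 val) /= fg; apply/funext => n.
have := graph_funP f n (f n) p_inj; rewrite fg graph_funP //.
by move=> /asboolP; rewrite asboolT // => /asboolP.
Qed.
(** * Discrete covers *)

Lemma discrete_subset_isolated (X : topologicalType) (A : set X) (x : X) :
  discrete_subset A -> A x -> exists2 U, nbhs x U & forall y, U y -> A y -> y = x.
Proof.
move=> dA Ax; pose a : A := exist _ x (mem_set Ax).
have : nbhs a [set a] by rewrite dA; apply/principal_filterP.
move=> [_ [[V oV <-] Vx VA]]; exists V; first exact: open_nbhs_nbhs.
by move=> y Vy Ay; have /(congr1 val) := VA (exist _ y (mem_set Ay)) Vy.
Qed.

Lemma discrete_subset_set1 (X : topologicalType) (x : X) : discrete_subset [set x].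
Proof.
have eqx (y z : [set x]) : y = z.
  by apply: val_inj; rewrite (set_mem (valP y)) (set_mem (valP z)).
apply/funext => y; apply/seteqP; split=> U.
  by move=> /nbhs_singleton Uy; apply/principal_filterP.
move=> /principal_filterP Uy; rewrite (_ : U = setT); first exact: filterT.
by apply/seteqP; split=> // z _; rewrite (eqx z y).
Qed.

Lemma card_discrete_cover_ge (K : Type) (D : set (set (Sigma_space K))) :
  infinite_set [set: K] -> discrete_cover D -> [set: nat -> K] #<= D.
Proof.
move=> infK [Ddisc Dcov].
have /card_leTP[i i_inj] : [set: nat * K] #<= [set: K].
  have /infiniteP/card_leTP[i i_inj] := infK.
  apply: card_le_trans (card_prod_le infK); apply/card_leTP.
  by exists (fun nk => (i nk.1, nk.2)) => -[m k] [n l] /= [/i_inj -> ->].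
pose x := Sigma_graph i.
have /choice[lab labP] : forall f, exists A : D, val A (x f).
  move=> f; have [A DA Ax] : (\bigcup_(A in D) A) (x f) by rewrite Dcov.
  by exists (exist _ A (mem_set DA)).
have /choice[depth depthP] : forall f, exists n, forall g,
    mkseq f n = mkseq g n -> val (lab f) (x g) -> g = f.
  move=> f; have [U xU UA] :=
    discrete_subset_isolated (Ddisc _ (set_mem (valP (lab f)))) (labP f).
  have [n nU] := Sigma_graph_continuous i_inj xU.
  by exists n => g /nU Ug Ag; apply: (Sigma_graph_inj i_inj); exact: UA.
rewrite -(card_le_eqr (card_setT D)).
apply: (@card_fun_le_labels K D lab depth infK) => f g lfg fg.
by apply/esym/depthP => //; rewrite lfg.
Qed.

(** Sequences of lists stand for partial sequences: an entry [:: a] puts [a] in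
    the support, and an empty entry adds nothing. *)
Lemma card_Sigma_space_le (K : Type) : infinite_set [set: K] ->
  [set: Sigma_space K] #<= [set: nat -> K].
Proof.
move=> infK; have /card_leTP[c c_inj] := card_seq_le infK.
have /choice[e eP] : forall x : Sigma_space K, exists e : nat -> seq K,
    forall a, val x a <-> exists n, e n = [:: a].
  move=> x; have /countable_injP[h h_inj] : countable [set a | val x a != false].
    exact: (set_mem (valP x)).
  have /choice[e eP] : forall n, exists s, forall a, s = [:: a] <-> val x a /\ h a = n.
    move=> n; have [[a [xa an]]|na] := pselect (exists a, val x a /\ h a = n).
      exists [:: a] => b; split=> [[<-]//|[xb bn]].
      by congr [:: _]; apply: h_inj; rewrite ?inE /= ?xa ?xb ?an ?bn.
    by exists [::] => a; split=> // xa; case: na; exists a.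
  exists e => a; split=> [xa|[n /eP[]//]].
  by exists (h a); apply/eP.
apply/card_leTP; exists (fun x n => c (e x n)) => x y exy.
apply: val_inj; apply/funext => a; apply/idP/idP => /eP[n en]; apply/eP; exists n;
  rewrite -en; apply: c_inj; by have := congr1 (@^~ n) exy.
Qed.

Unset Implicit Arguments.

Theorem theorem2p19 (K : Type) (hK : infinite_set [set: K]) :
  dis_is (Sigma_space K) [set: nat -> K].
Proof.
split=> [|D]; last exact: card_discrete_cover_ge.
have cov : discrete_cover (range (@set1 (Sigma_space K))).
  split=> [_ [x _ <-]|]; first exact: discrete_subset_set1.
  by apply/seteqP; split=> // x _; exists [set x].
exists (range set1) => //; rewrite card_eq_le card_discrete_cover_ge // andbT.
exact: card_le_trans (card_image_le _ _) (card_Sigma_space_le hK).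
Qed.
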